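(* Let $p\neq q$ be positive coprime integers. If $q\geqslant 59\,p$, then the Diophantine equation $Q_{pq}(t)=0$ has no integer solution $t$ such that the triple $(p,q,t)$ provides a perfect cuboid.
   Context: For positive integers $p,q$ the polynomial $Q_{pq}(t)$ is $$Q_{pq}(t)=t^{10}+(2q^2+p^2)(3q^2-2p^2)\,t^8+(q^8+10p^2q^6+4p^4q^4-14p^6q^2+p^8)\,t^6-p^2q^2(q^8-14p^2q^6+4p^4q^4+10p^6q^2+p^8)\,t^4-p^6q^6(q^2+2p^2)(3p^2-2q^2)\,t^2-q^{10}p^{10}.$$ A perfect cuboid is a 7-tuple of positive integers $x_1,x_2,x_3$ (edges), $d_1,d_2,d_3$ (face diagonals), $L$ (space diagonal) with $x_1^2+x_2^2+x_3^2=L^2$, $x_2^2+x_3^2=d_1^2$, $x_3^2+x_1^2=d_2^2$, $x_1^2+x_2^2=d_3^2$. An integer triple $(p,q,t)$ with $t\ne 0$ and $Q_{pq}(t)=0$ provides a perfect cuboid if for $(a,b,u)=(pq,\,p^2,\,q^2)$ or for $(a,b,u)=(p^2,\,pq,\,q^2)$ the following holds: setting $\alpha=a/t$, $\beta=b/t$, $\upsilon=u/t$, the number $$z=\frac{(1+\upsilon^2)(1-\beta^2)(1+\alpha^2)}{2(1+\beta^2)(1-\alpha^2\upsilon^2)}$$ is well defined, and for some positive integer $L$ the numbers given by $$\frac{x_1}{L}=\frac{2\upsilon}{1+\upsilon^2},\quad \frac{d_1}{L}=\frac{1-\upsilon^2}{1+\upsilon^2},\quad \frac{x_2}{L}=\frac{2z(1-\upsilon^2)}{(1+\upsilon^2)(1+z^2)},\quad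 \frac{x_3}{L}=\frac{(1-\upsilon^2)(1-z^2)}{(1+\upsilon^2)(1+z^2)},$$ $$\frac{d_2}{L}=\frac{(1+\upsilon^2)(1+z^2)+2z(1-\upsilon^2)}{(1+\upsilon^2)(1+z^2)}\,\beta,\quad \frac{d_3}{L}=\frac{2(\upsilon^2z^2+1)}{(1+\upsilon^2)(1+z^2)}\,\alpha$$ form, together with $L$, a perfect cuboid. *)

(* Defs.v *)
From mathcomp Require Import all_boot all_order all_algebra.

Set Implicit Arguments.
Unset Strict Implicit.
Unset Printing Implicit Defensive.

Import Order.TTheory GRing.Theory Num.Theory.
Local Open Scope ring_scope.

Definition Qpoly (p q : int) : {poly int} :=
  'X^10
  + ((2 * q ^+ 2 + p ^+ 2) * (3 * q ^+ 2 - 2 * p ^+ 2)) *: 'X^8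
  + (q ^+ 8 + 10 * p ^+ 2 * q ^+ 6 + 4 * p ^+ 4 * q ^+ 4
       - 14 * p ^+ 6 * q ^+ 2 + p ^+ 8) *: 'X^6
  - (p ^+ 2 * q ^+ 2
       * (q ^+ 8 - 14 * p ^+ 2 * q ^+ 6 + 4 * p ^+ 4 * q ^+ 4
            + 10 * p ^+ 6 * q ^+ 2 + p ^+ 8)) *: 'X^4
  - (p ^+ 6 * q ^+ 6 * (q ^+ 2 + 2 * p ^+ 2)
       * (3 * p ^+ 2 - 2 * q ^+ 2)) *: 'X^2
  - (q ^+ 10 * p ^+ 10)%:P.

Definition perfect_cuboid (x1 x2 x3 d1 d2 d3 L : int) : Prop :=
  [/\ [/\ 0 < x1, 0 < x2 & 0 < x3],
      [/\ 0 < d1, 0 < d2, 0 < d3 & 0 < L],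
      x1 ^+ 2 + x2 ^+ 2 + x3 ^+ 2 = L ^+ 2
    & [/\ x2 ^+ 2 + x3 ^+ 2 = d1 ^+ 2,
          x3 ^+ 2 + x1 ^+ 2 = d2 ^+ 2
        & x1 ^+ 2 + x2 ^+ 2 = d3 ^+ 2]].

Definition z_num (alpha beta upsilon : rat) : rat :=
  (1 + upsilon ^+ 2) * (1 - beta ^+ 2) * (1 + alpha ^+ 2).

Definition z_den (alpha beta upsilon : rat) : rat :=
  2 * (1 + beta ^+ 2) * (1 - alpha ^+ 2 * upsilon ^+ 2).

(* Division by zero yields 0 in rat, so "z is well defined" is the explicit
   condition z_den != 0.  The other denominators, 1 + upsilon ^+ 2 and
   1 + z ^+ 2, never vanish in rat. *)
Definition rational_data_give_cuboid (alpha beta upsilon : rat) : Prop :=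
  z_den alpha beta upsilon != 0 /\
  let z := z_num alpha beta upsilon / z_den alpha beta upsilon in
  exists x1 x2 x3 d1 d2 d3 L : int,
    [/\ perfect_cuboid x1 x2 x3 d1 d2 d3 L,
        [/\ x1%:~R / L%:~R = 2 * upsilon / (1 + upsilon ^+ 2),
            x2%:~R / L%:~R = 2 * z * (1 - upsilon ^+ 2)
                               / ((1 + upsilon ^+ 2) * (1 + z ^+ 2))
          & x3%:~R / L%:~R = (1 - upsilon ^+ 2) * (1 - z ^+ 2)
                               / ((1 + upsilon ^+ 2) * (1 + z ^+ 2))]
      & [/\ d1%:~R / L%:~R = (1 - upsilon ^+ 2) / (1 + upsilon ^+ 2),
            d2%:~R / L%:~R = ((1 + upsilon ^+ 2) * (1 + z ^+ 2)
                                + 2 * z * (1 - upsilon ^+ 2))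
                               / ((1 + upsilon ^+ 2) * (1 + z ^+ 2)) * beta
          & d3%:~R / L%:~R = 2 * (upsilon ^+ 2 * z ^+ 2 + 1)
                               / ((1 + upsilon ^+ 2) * (1 + z ^+ 2)) * alpha]].

Definition scaled_data_give_cuboid (t a b u : int) : Prop :=
  rational_data_give_cuboid (a%:~R / t%:~R) (b%:~R / t%:~R) (u%:~R / t%:~R).

Definition provides_perfect_cuboid (p q t : int) : Prop :=
  [/\ t != 0, (Qpoly p q).[t] = 0
    & scaled_data_give_cuboid t (p * q) (p ^+ 2) (q ^+ 2)
      \/ scaled_data_give_cuboid t (p ^+ 2) (p * q) (q ^+ 2)].

(* Main.v *)
(** A cuboid has [d1 > 0], which forces [upsilon ^+ 2 < 1], i.e. [q ^+ 4 < t ^+ 2].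
    In that range, with [q] at least [2 p], each negative term of [Q_pq(t)] is
    dominated by a positive one of higher degree, so [Q_pq(t) > 0]. *)

Require Import Defs.
From mathcomp Require Import all_boot all_order all_algebra.
From mathcomp Require Import ring lra.

Set Implicit Arguments.
Unset Strict Implicit.
Unset Printing Implicit Defensive.

Import Order.TTheory GRing.Theory Num.Theory.
Local Open Scope ring_scope.

(* [Q_pq(t)] in the variables [P = p ^+ 2], [S = q ^+ 2], [T = t ^+ 2]. *)
Lemma Qpoly_squares_gt0 (R : realDomainType) (P S T : R) :
  0 < P -> 2 * P <= S -> S ^+ 2 < T ->
  0 < T ^+ 5 + (2 * S + P) * (3 * S - 2 * P) * T ^+ 4
      + (S ^+ 4 + 10 * P * S ^+ 3 + 4 * P ^+ 2 * S ^+ 2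
           - 14 * P ^+ 3 * S + P ^+ 4) * T ^+ 3
      - P * S * (S ^+ 4 - 14 * P * S ^+ 3 + 4 * P ^+ 2 * S ^+ 2
           + 10 * P ^+ 3 * S + P ^+ 4) * T ^+ 2
      - P ^+ 3 * S ^+ 3 * (S + 2 * P) * (3 * P - 2 * S) * T
      - S ^+ 5 * P ^+ 5.
Proof.
move=> P_gt0 le_2PS lt_S2T.
have P_ge0 := ltW P_gt0.
have S_gt0 : 0 < S by lra.
have S_ge0 := ltW S_gt0.
have T_ge0 : 0 <= T by rewrite (le_trans _ (ltW lt_S2T)) ?sqr_ge0.
(* With [S = 2 * P + d] and [d >= 0], the mixed-sign polynomials [a6] and [e] expand in [P] and [d]
   with positive coefficients only. *)
have [d Ed] : {d | d = S - 2 * P} by exists (S - 2 * P).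
have d_ge0 : 0 <= d by rewrite Ed subr_ge0.
have ES : S = 2 * P + d by rewrite Ed; ring.
set a6 := (X in _ + X * T ^+ 3).
(* [e] is chosen so that the [T ^+ 2] coefficient is [e * S - a6 * S ^+ 2]. *)
pose e := S ^+ 5 + 9 * P * S ^+ 4 + 18 * P ^+ 2 * S ^+ 3
          - 18 * P ^+ 3 * S ^+ 2 - 9 * P ^+ 4 * S - P ^+ 5.
have a6_ge0 : 0 <= a6.
  have -> : a6 = 85 * P ^+ 4 + 154 * P ^+ 3 * d + 88 * P ^+ 2 * d ^+ 2
                 + 18 * P * d ^+ 3 + d ^+ 4 by rewrite /a6 ES; ring.
  by rewrite !(ler0n, addr_ge0, mulr_ge0, exprn_ge0).
have e_ge0 : 0 <= e.
  have -> : e = 229 * P ^+ 5 + 503 * P ^+ 4 * d + 386 * P ^+ 3 * d ^+ 2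
                + 130 * P ^+ 2 * d ^+ 3 + 19 * P * d ^+ 4 + d ^+ 5.
    by rewrite /e ES; ring.
  by rewrite !(ler0n, addr_ge0, mulr_ge0, exprn_ge0).
have a8_ge0 : 0 <= (2 * S + P) * (3 * S - 2 * P) by apply: mulr_ge0; lra.
have a2_ge0 : 0 <= P ^+ 3 * S ^+ 3 * (S + 2 * P) * (2 * S - 3 * P).
  by rewrite !mulr_ge0 ?exprn_ge0 //; lra.
(* Since [P <= S], we get [S * P <= S ^+ 2 < T]: the leading term beats the constant one. *)
have SP5_lt : 0 < T ^+ 5 - (S * P) ^+ 5.
  rewrite subr_gt0 ltrXn2r ?mulr_ge0 //.
  by apply: le_lt_trans lt_S2T; rewrite expr2 ler_wpM2l //; lra.
set Q := (X in _ < X).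
(* Split [a6 * T ^+ 3] as [a6 * (T - S ^+ 2) * T ^+ 2 + a6 * S ^+ 2 * T ^+ 2]; the second part
   absorbs the negative [T ^+ 2] term and leaves [e * S * T ^+ 2]. Only the first summand has to be
   strictly positive. *)
have -> : Q = (T ^+ 5 - (S * P) ^+ 5) + ((2 * S + P) * (3 * S - 2 * P) * T ^+ 4
   + a6 * (T - S ^+ 2) * T ^+ 2 + e * S * T ^+ 2
   + P ^+ 3 * S ^+ 3 * (S + 2 * P) * (2 * S - 3 * P) * T).
  by rewrite /Q /e /a6; ring.
rewrite ltr_pwDl // !addr_ge0 //.
- by rewrite mulr_ge0 ?exprn_ge0.
- by rewrite !mulr_ge0 ?exprn_ge0 // subr_ge0 ltW.
- by rewrite !mulr_ge0 ?exprn_ge0.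
- exact: mulr_ge0.
Qed.

Lemma Qpoly_gt0 (p q t : int) :
  0 < p -> 2 * p <= q -> q ^+ 4 < t ^+ 2 -> 0 < (Qpoly p q).[t].
Proof.
move=> p_gt0 le_2pq lt_q4t2.
rewrite /Qpoly !(hornerD, hornerN, hornerZ, hornerXn, hornerC).
have P_gt0 : 0 < p ^+ 2 by rewrite exprn_gt0.
(* Squaring [2 * p <= q] gives even [4 * p ^+ 2 <= q ^+ 2]. *)
have le_2PS : 2 * p ^+ 2 <= q ^+ 2 by nra.
have lt_S2T : (q ^+ 2) ^+ 2 < t ^+ 2 by rewrite -exprM.
have := Qpoly_squares_gt0 P_gt0 le_2PS lt_S2T.
by congr (_ < _); ring.
Qed.

Lemma scaled_data_upsilon_lt1 (t a b u : int) :
  t != 0 -> scaled_data_give_cuboid t a b u -> u ^+ 2 < t ^+ 2.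
Proof.
move=> t0 [_ [x1 [x2 [x3 [d1 [d2 [d3 [L]]]]]]]].
case=> [[_ [d1_gt0 _ _ L_gt0] _ _] _ [Ed1 _ _]].
have : 0 < d1%:~R / L%:~R :> rat by rewrite divr_gt0 ?ltr0z.
rewrite Ed1 pmulr_lgt0; last by rewrite invr_gt0 ltr_pwDl ?sqr_ge0.
rewrite subr_gt0 expr_div_n.
rewrite ltr_pdivrMr ?mul1r -?rmorphXn ?ltr_int //=.
by rewrite ltr0z exprn_even_gt0.
Qed.

Theorem theorem8p5 (p q : int) (hp : 0 < p) (hq : 0 < q) (hpq : p != q)
  (hcop : coprimez p q) (hq59 : 59 * p <= q) :
  ~ (exists t : int, (Qpoly p q).[t] = 0 /\ provides_perfect_cuboid p q t).
Proof.
move=> [t [_ [t0 Qt0 cuboid]]].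
have lt_q4t2 : q ^+ 4 < t ^+ 2.
  rewrite (exprM q 2 2).
  (* Both choices of [(a, b, u)] have [u = q ^+ 2], so either case yields the same bound. *)
  by case: cuboid => /(scaled_data_upsilon_lt1 t0).
have le_2pq : 2 * p <= q by lra.
by have := Qpoly_gt0 hp le_2pq lt_q4t2; rewrite Qt0 ltxx.
Qed.
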